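(* Let $\Omega$ be a countably infinite set with transition rates $\gamma_{i\to j}\ge0$ ($\gamma_{i\to i}=0$) such that the network is irreducible and has only bidirectional links, i.e. $\gamma_{\alpha\to\beta}>0\iff\gamma_{\beta\to\alpha}>0$ for all $\alpha,\beta\in\Omega$. Let $P_0,P_*$ be probability vectors on $\Omega$ and let $M_0\subseteq\Omega$ be a finite set with $P_0(M_0)>0$ and $P_*(M_0)>0$ whose subnetwork is strongly connected. Assume that for every finite set $M\supseteq M_0$ whose subnetwork is strongly connected one has $$P^M_\infty(P_0^{[M]})=P_*^{[M]}.$$ Then $P^M_\infty(P_0^{[M]})\to P_*$ in $\|\cdot\|_1$ along the net of all finite sets $M\subseteq\Omega$ with $P_0(M)>0$, ordered by inclusion.
   Context: A probability vector is $P\in[0,\infty)^\Omega$ with $\|P\|_1=\sum_\omega P^{(\omega)}=1$; for $A\subseteq\Omega$, $P(A)=\sum_{a\in A}P^{(a)}$. For a finite set $F$ with $P(F)>0$, $P^{[F]}$ is the probability vector with entries $P^{(i)}/P(F)$ for $i\in F$ and $0$ for $i\notin F$. The network is the directed graph on $\Omega$ with a link $i\to j$ whenever $\gamma_{i\to j}>0$; it is irreducible if it is strongly connected. The subnetwork of a set $F\subseteq\Omega$ is the induced directed subgraph on $F$. For finite $F\subseteq\Omega$, $\Gamma^{[F]}$ is the $\Omega\times\Omega$ matrix with $(\Gamma^{[F]})^{(i,j)}=\gamma_{j\to i}$ if $i\neq j$, $i,j\in F$; $(\Gamma^{[F]})^{(j,j)}=-\sum_{f\in F}\gamma_{j\to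 f}$ if $j\in F$; all other entries $0$. For finite $F$ with $P_0(F)>0$, $P^F_\infty(P_0^{[F]}):=\lim_{t\to\infty}e^{t\Gamma^{[F]}}P_0^{[F]}$ (this limit always exists, the problem being finite dimensional). *)

(* Defs.v *)
From HB Require Import structures.
From mathcomp Require Import all_boot all_order all_algebra finmap.
From mathcomp Require Import all_classical all_reals all_analysis.

Set Implicit Arguments.
Unset Strict Implicit.
Unset Printing Implicit Defensive.

Import Order.TTheory GRing.Theory Num.Theory.
Import numFieldNormedType.Exports.

Local Open Scope classical_set_scope.
Local Open Scope ring_scope.

Definition norm1 (R : realType) (Omega : choiceType) (v : Omega -> R) : \bar R :=
  (\esum_(i in [set: Omega]) `|v i|%:E)%E.

Definition probability_vector (R : realType) (Omega : choiceType)
    (P : Omega -> R) : Prop :=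
  (forall i, 0 <= P i) /\ norm1 P = 1%E.

Definition mass (R : realType) (Omega : choiceType)
    (P : Omega -> R) (F : {fset Omega}) : R :=
  \sum_(a <- F) P a.

(* [restrict_normalize P F] is P^{[F]}; it is meaningful when [0 < mass P F]. *)
Definition restrict_normalize (R : realType) (Omega : choiceType)
    (P : Omega -> R) (F : {fset Omega}) : Omega -> R :=
  fun i => if i \in F then P i / mass P F else 0.

(* [gamma i j] is the rate of the transition i -> j. *)
Definition link (R : realType) (Omega : choiceType)
    (gamma : Omega -> Omega -> R) : rel Omega :=
  fun i j => 0 < gamma i j.

(* Strong connectedness of the directed subgraph induced on [A]: the
   intermediate vertices of the paths must lie in [A] as well. *)
Definition strongly_connected (R : realType) (Omega : choiceType)
    (gamma : Omega -> Omega -> R) (A : set Omega) : Prop :=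
  forall i j, A i -> A j ->
    exists p : seq Omega,
      [/\ path (link gamma) i p, last i p = j & {in p, forall k, A k}].

Definition irreducible (R : realType) (Omega : choiceType)
    (gamma : Omega -> Omega -> R) : Prop :=
  strongly_connected gamma [set: Omega].

Definition generator (R : realType) (Omega : choiceType)
    (gamma : Omega -> Omega -> R) (F : {fset Omega}) : Omega -> Omega -> R :=
  fun i j =>
    if (i \in F) && (j \in F) then
      if i == j then - \sum_(f <- F) gamma j f else gamma j i
    else 0.

(* Omega x Omega matrices and vectors are plain functions.  The sums over
   [set: Omega] below are the library's finitely supported sums (0 by
   convention if the support is infinite); in every use made of them here
   the support is finite, because [generator gamma F] vanishes outside F x F. *)
Definition mat_mul (R : realType) (Omega : choiceType)
    (A B : Omega -> Omega -> R) : Omega -> Omega -> R :=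
  fun i j => \sum_(k \in [set: Omega]) A i k * B k j.

Definition mat_app (R : realType) (Omega : choiceType)
    (A : Omega -> Omega -> R) (v : Omega -> R) : Omega -> R :=
  fun i => \sum_(j \in [set: Omega]) A i j * v j.

Definition mat_pow (R : realType) (Omega : choiceType)
    (A : Omega -> Omega -> R) (n : nat) : Omega -> Omega -> R :=
  iter n (mat_mul A) (fun i j => (i == j)%:R).

Definition mat_exp (R : realType) (Omega : choiceType)
    (A : Omega -> Omega -> R) : Omega -> Omega -> R :=
  fun i j => limn (series (fun n => n`!%:R^-1 * mat_pow A n i j)).

(* The limit as t -> +oo of e^{t Gamma^{[F]}} v, taken entrywise: for v
   supported in F all these vectors are supported in the finite set F, so
   entrywise and l^1 convergence coincide. *)
Definition Pinfty (R : realType) (Omega : choiceType)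
    (gamma : Omega -> Omega -> R) (F : {fset Omega}) (v : Omega -> R) :
    Omega -> R :=
  fun i =>
    lim (mat_app (mat_exp (fun a b => t * generator gamma F a b)) v i
         @[t --> +oo]).

(* The filter of tails of the net of all finite sets of positive P-mass,
   directed by inclusion. *)
Definition fset_net (R : realType) (Omega : choiceType) (P : Omega -> R) :
    set_system {fset Omega} :=
  filter_from [set A : {fset Omega} | 0 < mass P A]
    (fun A => [set B : {fset Omega} | 0 < mass P B /\ (A `<=` B)%fset]).

(* Main.v *)
Require Import Defs.
From HB Require Import structures.
From mathcomp Require Import all_boot all_order all_algebra finmap.
From mathcomp Require Import all_classical all_reals all_analysis.
From mathcomp Require Import ring lra.

Set Implicit Arguments.
Unset Strict Implicit.
Unset Printing Implicit Defensive.

Import Order.TTheory GRing.Theory Num.Theory.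
Import numFieldNormedType.Exports.

Local Open Scope classical_set_scope.
Local Open Scope ring_scope.

(** Let [C] be the connected component of [M] that contains [M0].  The links
being bidirectional, [C] is closed under the dynamics of [M], so on [C] the
vector [x = P^M_infty (P0^[M])] is [P0(C) / P0(M)] times
[P^C_infty (P0^[C]) = Pstar^[C]]; hence [x >= P0(C) * Pstar] on [C].  As [x] is
nonnegative of mass at most 1 and vanishes off [M], this gives
[|x - Pstar|_1 <= 2 * (1 - P0(C) * Pstar(C))].  By irreducibility [C] contains
any prescribed finite set once [M] is large, so the bound tends to 0.

The semigroup enters only through the nonnegativity and the unit column sums of
[e^{t Gamma}]. *)

(** * Exponential generating series and binomial transforms *)

Definition egf (R : realType) (a : nat -> R) : nat -> R :=
  fun n => n`!%:R^-1 * a n.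

Definition binomial_transform (R : realType) (l : R) (a : nat -> R) : nat -> R :=
  fun n => \sum_(k < n.+1) 'C(n, k)%:R * (l ^+ (n - k) * a k).

(** Pascal's rule. For entries of matrix powers this is the recursion (A + l)^(n+1) = l (A + l)^n +
    A (A + l)^n. *)
Lemma binomial_transformS (R : realType) (l : R) (a : nat -> R) n :
  binomial_transform l a n.+1 =
  l * binomial_transform l a n + binomial_transform l (fun k => a k.+1) n.
Proof.
rewrite /binomial_transform big_ord_recl /= bin0 subn0.
under eq_bigr do rewrite /bump /= add1n binS natrD mulrDl subSS.
rewrite big_split /= addrA; congr (_ + _).
rewrite [in RHS]big_ord_recl /= bin0 subn0 mulrDr exprS -!mulrA; congr (_ + _).
  by rewrite !mul1r.
rewrite big_ord_recr /= bin_small // mul0r addr0 mulr_sumr.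
apply: eq_bigr => k _; rewrite /bump /= add1n.
rewrite [RHS]mulrCA; congr (_ * _); rewrite mulrA -exprS.
by congr (_ ^+ _ * _); rewrite -subSn.
Qed.

Lemma binomial_transform_expr (R : realType) (l c : R) n :
  binomial_transform l (GRing.exp c) n = (l + c) ^+ n.
Proof. by rewrite exprDn; apply: eq_bigr => k _; rewrite mulr_natl. Qed.

Lemma binomial_transformD (R : realType) (l : R) (a b : nat -> R) n :
  binomial_transform l (a \+ b) n =
  binomial_transform l a n + binomial_transform l b n.
Proof. by rewrite -big_split; apply: eq_bigr => k _ /=; rewrite !mulrDr. Qed.

Lemma egf_expr (R : realType) (c : R) : egf (GRing.exp c) = exp_coeff c.
Proof. by apply/funext => n; rewrite /egf /exp_coeff /= mulrC. Qed.

Lemma egfD (R : realType) (a b : nat -> R) : egf (a \+ b) = egf a \+ egf b.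
Proof. by apply/funext => n; rewrite /egf /= mulrDr. Qed.

(** Since C(n,k) / n! = 1 / (k! (n-k)!), these terms form the Cauchy product of the series of
    [egf a] and of e^l. *)
Lemma egf_binomial_transform (R : realType) (l : R) (a : nat -> R) n :
  egf (binomial_transform l a) n =
  \sum_(k < n.+1) egf a k * exp_coeff l (n - k)%N.
Proof.
rewrite /egf mulr_sumr; apply: eq_bigr => k _; rewrite /exp_coeff /=.
have lekn : (k <= n)%N by rewrite -ltnS.
have /(congr1 (fun m => m%:R : R)) := bin_fact lekn; rewrite !natrM => <-.
have k0 : k`!%:R != 0 :> R by rewrite pnatr_eq0 -lt0n fact_gt0.
have nk0 : (n - k)`!%:R != 0 :> R by rewrite pnatr_eq0 -lt0n fact_gt0.
have b0 : 'C(n, k)%:R != 0 :> R by rewrite pnatr_eq0 -lt0n bin_gt0.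
by field; rewrite k0 nk0 b0.
Qed.

Lemma series_egf_binomial_transform (R : realType) (l : R) (a : nat -> R) N :
  series (egf (binomial_transform l a)) N =
  \sum_(k < N) egf a k * series (exp_coeff l) (N - k)%N.
Proof.
elim: N => [|N IHN]; first by rewrite /series /= big_geq // big_ord0.
rewrite seriesSr IHN egf_binomial_transform.
under [RHS]eq_bigr => k _ do rewrite subSn -1?ltnS // seriesSr mulrDr.
rewrite big_split /= [in RHS]big_ord_recr /= subnn.
by rewrite [series _ 0]big_geq // mulr0 addr0.
Qed.

Lemma series_exp_coeff_le_expR (R : realType) (l : R) n :
  0 <= l -> series (exp_coeff l) n <= expR l.
Proof.
move=> l0; apply: nondecreasing_cvgn_le; last exact: is_cvg_series_exp_coeff.
by apply: nondecreasing_series => k _ _; exact: exp_coeff_ge0.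
Qed.

(** Nonnegativity of [a] lets every truncated exponential series be replaced by its limit; this
    inequality between partial sums stands in for the limit of the Cauchy product. *)
Lemma series_egf_binomial_transform_le (R : realType) (l : R) (a : nat -> R) N :
  0 <= l -> (forall n, 0 <= a n) ->
  series (egf (binomial_transform l a)) N <= expR l * series (egf a) N.
Proof.
move=> l0 a0.
rewrite series_egf_binomial_transform [series (egf a)]seriesEord /= mulr_sumr.
apply: ler_sum => k _; rewrite mulrC ler_wpM2r ?series_exp_coeff_le_expR //.
by rewrite mulr_ge0 ?invr_ge0.
Qed.

Lemma is_cvg_series_egf (R : realType) (a : nat -> R) (c : R) :
  (forall n, `|a n| <= c ^+ n) -> cvgn (series (egf a)).
Proof.
move=> ac; apply: normed_cvg.
apply: (@series_le_cvg _ _ (exp_coeff c)); last exact: is_cvg_series_exp_coeff.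
- by move=> n; exact: normr_ge0.
- by move=> n; rewrite mulr_ge0 ?invr_ge0 // (le_trans _ (ac n)).
- move=> n; rewrite -egf_expr /egf /= normrM ger0_norm ?invr_ge0 //.
  by rewrite ler_wpM2l ?invr_ge0.
Qed.

(* Entrywise form of e^A = e^{-l} e^{A + l}: the binomial transform of the
   entries of A^n are those of (A + l)^n. *)
Lemma lim_series_egf_ge0 (R : realType) (a : nat -> R) (c l : R) :
  0 <= l -> (forall n, `|a n| <= c ^+ n) ->
  (forall n, 0 <= binomial_transform l a n) ->
  0 <= limn (series (egf a)).
Proof.
move=> l0 ac a0; have cvga := is_cvg_series_egf ac.
rewrite -(@pmulr_rge0 _ (expR l)) ?expR_gt0 //.
(* The sequence [a] may change sign, but [a n + c ^ n] is nonnegative, so the inequality between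
   partial sums applies to it. The transform of [c ^ n] is [(l + c) ^ n] and that of [a] is
   nonnegative, which leaves the lower bound [u]; it tends to e^(l+c) - e^l e^c = 0. *)
set u := fun N => series (exp_coeff (l + c)) N - expR l * series (exp_coeff c) N.
have u0 : u @ \oo --> 0.
  have -> : (0 : R) = expR (l + c) - expR l * expR c by rewrite expRD subrr.
  apply: cvgB; first exact: is_cvg_series_exp_coeff.
  by apply: cvgMl_tmp; exact: is_cvg_series_exp_coeff.
have le_u N : u N <= expR l * series (egf a) N.
  have := @series_egf_binomial_transform_le R l (a \+ GRing.exp c) N l0.
  rewrite egfD egf_expr -[series (_ \+ _)]/(series (egf a + exp_coeff c)).
  rewrite seriesD mulrDr.
  have aD0 n : 0 <= (a \+ GRing.exp c) n.
    by rewrite /= addrC -lerBlDr sub0r (le_trans _ (ac n)) // -normrN ler_norm.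
  move=> /(_ aD0).
  have -> : egf (binomial_transform l (a \+ GRing.exp c)) =
      egf (binomial_transform l a) + exp_coeff (l + c).
    apply/funext => n; rewrite -egf_expr /egf binomial_transformD mulrDr.
    by rewrite binomial_transform_expr.
  rewrite seriesD -[(series _ + series _) N]/(series _ N + series _ N).
  rewrite /u lerBlDr; apply: le_trans; rewrite lerDr seriesEord /=.
  by apply: sumr_ge0 => n _; rewrite mulr_ge0 ?invr_ge0.
have cvgv : expR l * series (egf a) N @[N --> \oo] -->
    expR l * limn (series (egf a)) by apply: cvgMl_tmp; exact: cvga.
rewrite -(cvg_lim _ cvgv) // -[leLHS](cvg_lim _ u0) //.
by apply: ler_lim; [exact: cvgP u0|exact: cvgP cvgv|exact: nearW].
Qed.

(** * Finite sums and exponentials of finitely supported matrices *)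

Lemma cvg_sumr (R : realType) (T I : Type) (F : set_system T)
    (FF : Filter F) (r : seq I) (f : I -> T -> R) (l : I -> R) :
  (forall i, f i x @[x --> F] --> l i) ->
  \sum_(i <- r) f i x @[x --> F] --> \sum_(i <- r) l i.
Proof. by move=> fl; apply: cvg_big => //; exact: add_continuous. Qed.

Lemma fsbig_setT_fset (R : realType) (Omega : choiceType) (F : {fset Omega})
    (f : Omega -> R) :
  (forall i, i \notin F -> f i = 0) ->
  \sum_(i \in [set: Omega]) f i = \sum_(i <- F) f i.
Proof.
move=> f0; rewrite (fsbigE (enum_fset F)) ?fset_uniq //; last by move=> i _ /f0.
by apply: eq_bigl => i; rewrite in_setT.
Qed.

Lemma big_fset_eqb (R : realType) (Omega : choiceType) (F : {fset Omega}) j :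
  j \in F -> \sum_(i <- F) (i == j)%:R = 1 :> R.
Proof.
move=> jF; rewrite (bigD1_seq j) ?fset_uniq //= eqxx big1 ?addr0 // => i.
by move=> /negbTE ->.
Qed.

Definition supported_on (R : realType) (Omega : choiceType)
    (A : Omega -> Omega -> R) (F : {fset Omega}) : Prop :=
  forall i j, ~~ ((i \in F) && (j \in F)) -> A i j = 0.

Section finite_support.
Variables (R : realType) (Omega : choiceType).
Variables (A : Omega -> Omega -> R) (F : {fset Omega}).
Hypothesis AF : supported_on A F.

Lemma mat_powS n i j :
  mat_pow A n.+1 i j = \sum_(k <- F) A i k * mat_pow A n k j.
Proof.
rewrite /mat_pow iterS /mat_mul; apply: fsbig_setT_fset => k kF.
by rewrite AF ?mul0r // (negbTE kF) andbF.
Qed.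

(** Only the mixed entries vanish for every [n]: the zeroth power is the identity on all of [Omega],
    with ones on the diagonal outside [F]. *)
Lemma mat_pow_eq0 n i j : (i \in F) != (j \in F) -> mat_pow A n i j = 0.
Proof.
elim: n i => [|n IHn] i ij.
  by rewrite /mat_pow /=; case: (eqVneq i j) ij => // ->; rewrite eqxx.
rewrite mat_powS big_seq big1 // => k kF.
move: ij; case: (boolP (i \in F)) => iF ij; last by rewrite AF ?mul0r // (negbTE iF).
by rewrite IHn ?mulr0 // kF.
Qed.

(** A crude bound for all row sums. It is both the growth rate of the powers and the diagonal shift
    that makes [A + K] nonnegative. *)
Let K := \sum_(i <- F) \sum_(k <- F) `|A i k|.

Lemma mat_row_norm_le i : \sum_(k <- F) `|A i k| <= K.
Proof.
have K0 : 0 <= K by do 2![apply: sumr_ge0 => ? _].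
have [iF|iF] := boolP (i \in F); last first.
  by rewrite big1 // => k _; rewrite AF ?normr0 // (negbTE iF).
rewrite /K [leRHS](bigD1_seq i) ?fset_uniq //= lerDl.
by do 2![apply: sumr_ge0 => ? _].
Qed.

Lemma mat_pow_norm_le n i j : `|mat_pow A n i j| <= K ^+ n.
Proof.
have K0 : 0 <= K by do 2![apply: sumr_ge0 => ? _].
elim: n i => [|n IHn] i; first by rewrite /mat_pow /=; case: eqP; rewrite ?normr1 ?normr0.
rewrite mat_powS exprS (le_trans (ler_norm_sum _ _ _)) //.
apply: le_trans (ler_wpM2r (exprn_ge0 n K0) (mat_row_norm_le i)).
by rewrite mulr_suml; apply: ler_sum => k _; rewrite normrM ler_wpM2l.
Qed.

Lemma is_cvg_mat_exp i j :
  cvgn (series (fun n => n`!%:R^-1 * mat_pow A n i j)).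
Proof. exact: is_cvg_series_egf (fun n => mat_pow_norm_le n i j). Qed.

Lemma mat_exp_eq0 i j : (i \in F) != (j \in F) -> mat_exp A i j = 0.
Proof.
move=> ij; rewrite /mat_exp (_ : series _ = fun=> 0) ?lim_cst //.
apply/funext => n; rewrite seriesEord /= big1 // => k _.
by rewrite mat_pow_eq0 ?mulr0.
Qed.

(** The entries of [A + K] are nonnegative, off the diagonal by hypothesis and on it because
    [|A i i| <= K]. So are those of its powers, which are the binomial transforms. *)
Lemma mat_exp_ge0 i j : (forall i j, i != j -> 0 <= A i j) -> 0 <= mat_exp A i j.
Proof.
move=> A0; have K0 : 0 <= K by do 2![apply: sumr_ge0 => ? _].
apply: lim_series_egf_ge0 (K0) (fun n => mat_pow_norm_le n i j) _ => n.
elim: n i => [|n IHn] i.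
  by rewrite /binomial_transform big_ord1 bin0 !mul1r /mat_pow /= ler0n.
have AK0 k : 0 <= (i == k)%:R * K + A i k.
  have [<-|ik] := eqVneq i k; last by rewrite mul0r add0r A0.
  rewrite mul1r -lerBlDr sub0r.
  have [iF|iF] := boolP (i \in F); last by rewrite AF ?oppr0 // (negbTE iF).
  apply: le_trans (mat_row_norm_le i); rewrite [leRHS](bigD1_seq i) ?fset_uniq //=.
  rewrite -normrN (le_trans (ler_norm _)) // lerDl.
  by apply: sumr_ge0.
(* The transform is linear in the sequence, so left multiplication by [A] passes through it. *)
have stepE : binomial_transform K (fun k => mat_pow A k.+1 i j) n =
    \sum_(k <- F) A i k * binomial_transform K (fun n => mat_pow A n k j) n.
  rewrite /binomial_transform.
  under eq_bigr do rewrite mat_powS !mulr_sumr.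
  rewrite exchange_big; apply: eq_bigr => k _; rewrite mulr_sumr.
  by apply: eq_bigr => m _; rewrite mulrCA [_ * (A i k * _)]mulrCA !mulrA; ring.
rewrite binomial_transformS stepE.
(* For [i] outside [F] the row of [A] is zero and only the shift acts; for [i] in [F] the shift
   enters the sum over [F] as [K] times a Kronecker delta. *)
have [iF|iF] := boolP (i \in F); last first.
  rewrite big1 ?addr0 ?mulr_ge0 // => k _.
  by rewrite AF ?mul0r // (negbTE iF).
have -> : K * binomial_transform K (fun n => mat_pow A n i j) n =
    \sum_(k <- F) (i == k)%:R * K * binomial_transform K (fun n => mat_pow A n k j) n.
  rewrite (bigD1_seq i) ?fset_uniq //= eqxx mul1r big1 ?addr0 // => k.
  by rewrite eq_sym => /negbTE ->; rewrite !mul0r.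
rewrite -big_split; apply: sumr_ge0 => k _ /=.
by rewrite -mulrDl mulr_ge0.
Qed.

(** The all-ones row vector annihilates [A], so among the powers only the zeroth has a nonzero
    column sum. *)
Lemma mat_exp_col_sum j :
  (forall k, \sum_(i <- F) A i k = 0) -> j \in F ->
  \sum_(i <- F) mat_exp A i j = 1.
Proof.
move=> A0 jF.
have pow_sum n : \sum_(i <- F) mat_pow A n i j = (n == 0)%:R.
  case: n => [|n]; first exact: big_fset_eqb.
  under eq_bigr do rewrite mat_powS.
  rewrite exchange_big big1 // => k _.
  by rewrite -mulr_suml A0 mul0r.
have cvgE : \sum_(i <- F) series (fun n => n`!%:R^-1 * mat_pow A n i j) N
    @[N --> \oo] --> \sum_(i <- F) mat_exp A i j.
  by apply: cvg_sumr => i; exact: is_cvg_mat_exp.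
rewrite -(cvg_lim _ cvgE) //; apply: cvg_lim => //.
(* The partial sums equal 1 from index 1 on; at index 0 the sum is empty. *)
apply: cvg_near_cst; exists 1%N => // n /= n0.
under eq_bigr do rewrite seriesEord /=.
rewrite exchange_big /=; under eq_bigr do rewrite -mulr_sumr pow_sum.
case: n n0 => // n _; rewrite big_ord_recl /= fact0 invr1 mulr1 big1 ?addr0 //.
by move=> k _; rewrite mulr0.
Qed.

(** The rows of [A] in [C] vanish outside [C], as those of [B] do, so the recursion for the powers,
    started in [C], never leaves [C]. *)
Lemma mat_exp_row_eq (B : Omega -> Omega -> R) (C : {fset Omega}) i j :
  supported_on B C -> (forall i k, i \in C -> A i k = B i k) ->
  i \in C -> mat_exp A i j = mat_exp B i j.
Proof.
move=> BC AB iC; rewrite /mat_exp; congr (limn (series _)); apply/funext => n.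
congr (_ * _); elim: n i iC => // n IHn i iC.
rewrite /mat_pow !iterS /mat_mul; apply: eq_fsbigr => k _; rewrite AB //.
have [kC|kC] := boolP (k \in C); first by rewrite -!/(mat_pow _ _) IHn.
by rewrite BC ?mul0r // (negbTE kC) andbF.
Qed.

Lemma mat_app_mat_exp (v : Omega -> R) i :
  (forall j, j \notin F -> v j = 0) ->
  mat_app (mat_exp A) v i = \sum_(j <- F) mat_exp A i j * v j.
Proof. by move=> v0; apply: fsbig_setT_fset => j /v0 ->; rewrite mulr0. Qed.

End finite_support.

(** * The Markov semigroup of a finite set and its limit *)

Section markov_semigroup.
Variables (R : realType) (Omega : choiceType) (gamma : Omega -> Omega -> R).
Hypothesis gamma_ge0 : forall i j, 0 <= gamma i j.
Hypothesis gamma_diag : forall i, gamma i i = 0.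

Definition evolve (F : {fset Omega}) (t : R) (v : Omega -> R) : Omega -> R :=
  mat_app (mat_exp (fun a b => t * generator gamma F a b)) v.

Lemma supported_generator (F : {fset Omega}) t :
  supported_on (fun a b => t * generator gamma F a b) F.
Proof. by move=> i j /negbTE; rewrite /generator => ->; rewrite mulr0. Qed.

Lemma generator_col_sum (F : {fset Omega}) t k :
  \sum_(i <- F) t * generator gamma F i k = 0.
Proof.
rewrite -mulr_sumr; have [kF|kF] := boolP (k \in F); last first.
  by rewrite big1 ?mulr0 // => i _; rewrite /generator (negbTE kF) andbF.
rewrite (bigD1_seq k) ?fset_uniq //= {1}/generator kF eqxx /=.
(* The diagonal entry sums over all of [F], including [k]; that term is zero, and the rest cancels
   the column. *)
rewrite (bigD1_seq k) ?fset_uniq //= gamma_diag add0r.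
rewrite [X in _ + X]big_seq_cond [X in - X]big_seq_cond.
rewrite [X in _ + X](eq_bigr (gamma k)) ?addNr ?mulr0 // => i /andP[iF ik].
by rewrite /generator iF kF (negbTE ik).
Qed.

Section supported.
Variables (F : {fset Omega}) (v : Omega -> R).
Hypothesis v_supp : forall j, j \notin F -> v j = 0.
Hypothesis v_ge0 : forall j, 0 <= v j.

Lemma evolve_eq0 t i : i \notin F -> evolve F t v i = 0.
Proof.
move=> iF; rewrite /evolve (mat_app_mat_exp _ _ v_supp) big_seq big1 // => j jF.
by rewrite (mat_exp_eq0 (@supported_generator _ t)) ?mul0r // jF (negbTE iF).
Qed.

Lemma evolve_ge0 t i : 0 <= t -> 0 <= evolve F t v i.
Proof.
move=> t0; rewrite /evolve (mat_app_mat_exp _ _ v_supp).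
apply: sumr_ge0 => j _; rewrite mulr_ge0 //.
apply: (mat_exp_ge0 (@supported_generator _ t)) => {}i {}j ij.
rewrite mulr_ge0 // /generator; case: ifP => // _.
by rewrite (negbTE ij).
Qed.

Lemma evolve_sum t : \sum_(i <- F) evolve F t v i = \sum_(i <- F) v i.
Proof.
under eq_bigr do rewrite /evolve (mat_app_mat_exp _ _ v_supp).
rewrite exchange_big /= big_seq [RHS]big_seq; apply: eq_bigr => j jF.
rewrite -mulr_suml (mat_exp_col_sum (@supported_generator _ t)) ?mul1r //.
exact: generator_col_sum.
Qed.

Lemma Pinfty_eq0 i : i \notin F -> Pinfty gamma F v i = 0.
Proof.
move=> iF; apply: cvg_lim => //.
by under eq_fun do rewrite -/(evolve F _ v) evolve_eq0 //; exact: cvg_cst.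
Qed.

Lemma Pinfty_ge0 i : 0 <= Pinfty gamma F v i.
Proof.
have [cvgv|dvgv] := pselect (cvg (evolve F t v i @[t --> +oo])); last first.
  (* A divergent entry takes the default value [point], which is 0. *)
  by rewrite /Pinfty (dvgP dvgv).
apply: limr_ge => //.
by near do rewrite evolve_ge0//; exact: nbhs_pinfty_ge.
Unshelve. all: by end_near. Qed.

(* An entry without a limit counts for [point = 0], so the convergence of the
   semigroup is not needed. *)
Lemma Pinfty_sum_le : \sum_(i <- F) Pinfty gamma F v i <= \sum_(i <- F) v i.
Proof.
(* Zeroing the divergent entries makes each entry converge to that of [Pinfty]; by nonnegativity the
   total only decreases. *)
set h := fun i t => if `[< cvg (evolve F t v i @[t --> +oo]) >]
  then evolve F t v i else 0.
have hP i : h i t @[t --> +oo] --> Pinfty gamma F v i.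
  rewrite /h; case: asboolP => [//|dvgv].
  by rewrite /Pinfty (dvgP dvgv); exact: cvg_cst.
have cvgh : \sum_(i <- F) h i t @[t --> +oo] -->
    \sum_(i <- F) Pinfty gamma F v i by exact: cvg_sumr.
rewrite -(cvg_lim _ cvgh) //; apply: limr_le; first exact: cvgP cvgh.
near=> t; rewrite -(evolve_sum t); apply: ler_sum => i _.
rewrite /h; case: ifP => // _; apply: evolve_ge0.
by near: t; exact: nbhs_pinfty_ge.
Unshelve. all: by end_near. Qed.

End supported.

(** No rate crosses between [C] and the rest of [F], so the rows in [C] of both generators, hence of
    both exponentials, coincide. *)
Lemma Pinfty_block (F C : {fset Omega}) (v w : Omega -> R) (c : R) i :
  (C `<=` F)%fset ->
  (forall j k, j \in C -> k \in F -> k \notin C ->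
    gamma j k = 0 /\ gamma k j = 0) ->
  (forall j, j \notin C -> w j = 0) ->
  c != 0 -> (forall j, j \in C -> v j = c * w j) ->
  i \in C -> Pinfty gamma F v i = c * Pinfty gamma C w i.
Proof.
move=> CF Cclosed w0 c0 vw iC.
have genE j k : j \in C -> generator gamma F j k = generator gamma C j k.
  move=> jC; rewrite /generator (fsubsetP CF _ jC) jC /=.
  have [kF|kF] := boolP (k \in F); last by rewrite (contraNF (fsubsetP CF k) kF).
  have [kC|kC] := boolP (k \in C); last first.
    by case: eqP jC kC => [-> -> //|_ jC kC]; have [] := Cclosed j k jC kF kC.
  (* The total exit rate of a point of [C] is the same in [F] as in [C]. *)
  case: eqP => // _; congr (- _); apply/esym/big_fset_incl => // f fF fC.
  by have [] := Cclosed k f kC fF fC.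
have evolveE t : evolve F t v i = c * evolve C t w i.
  rewrite /evolve [in RHS](mat_app_mat_exp _ _ w0) mulr_sumr /mat_app.
  rewrite -[RHS]fsbig_setT_fset; last by move=> j jC; rewrite w0 ?mulr0.
  apply: eq_fsbigr => j _.
  rewrite (@mat_exp_row_eq _ _ (fun a b => t * generator gamma F a b)
    (fun a b => t * generator gamma C a b) C) //; first last.
  - by move=> k l kC; rewrite genE.
  - exact: supported_generator.
  have [jC|jC] := boolP (j \in C); first by rewrite vw // mulrCA.
  rewrite (mat_exp_eq0 (@supported_generator _ t)) ?mul0r ?mulr0 //.
  by rewrite iC (negbTE jC).
rewrite /Pinfty -/(evolve _ _ _); under eq_fun do rewrite -/(evolve _ _ _) evolveE.
have [cvgw|dvgw] := pselect (cvg (evolve C t w i @[t --> +oo])).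
  by apply: cvg_lim => //; apply: cvgMl_tmp; exact: cvgw.
(* As [c != 0], divergence for [C] forces divergence for [F], and both limits default to 0. *)
rewrite (dvgP dvgw) dvgP ?mulr0 // => cw; apply: dvgw.
by rewrite -(is_cvgMlE_tmp _ c0).
Qed.

End markov_semigroup.

(** * Mass and distance in the 1-norm *)

Section l1.
Variables (R : realType) (Omega : choiceType).
Implicit Types (P x v : Omega -> R) (A B C M : {fset Omega}).

Lemma sum_fset_le_norm1 v A : ((\sum_(i <- A) `|v i|)%:E <= norm1 v)%E.
Proof.
apply: esum_ge; exists [set` A]; first by split => //; exact: finite_fset.
by rewrite fsbig_finite //= set_fsetK sumEFin.
Qed.

Lemma norm1_le v (c : R) :
  (forall A, \sum_(i <- A) `|v i| <= c) -> (norm1 v <= c%:E)%E.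
Proof.
move=> vc; apply: ge_ereal_sup => _ [X [finX _] <-].
by rewrite fsbig_finite //= sumEFin lee_fin.
Qed.

Lemma le_mass P A B :
  (forall i, 0 <= P i) -> (A `<=` B)%fset -> mass P A <= mass P B.
Proof.
move=> P0 AB; rewrite /mass.
have -> : \sum_(a <- A) P a = \sum_(a <- B) (if a \in A then P a else 0).
  rewrite -(big_fset_incl _ AB) => [|a _ /negbTE -> //].
  by rewrite big_seq [RHS]big_seq; apply: eq_bigr => a ->.
by apply: ler_sum => a _; case: ifP.
Qed.

Lemma mass_le1 P A : probability_vector P -> mass P A <= 1.
Proof.
move=> [P0 P1]; rewrite -lee_fin -P1; apply: le_trans (sum_fset_le_norm1 P A).
by rewrite lee_fin /mass; apply: ler_sum => i _; exact: ler_norm.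
Qed.

Lemma mass_near1 P (e : R) :
  probability_vector P -> 0 < e -> exists A, 1 - e < mass P A.
Proof.
move=> [P0 P1] e0; apply: contrapT => /forallNP small.
have /norm1_le : forall A, \sum_(i <- A) `|P i| <= 1 - e.
  move=> A; rewrite leNgt; apply/negP => eA; apply: (small A).
  by apply: lt_le_trans eA _; apply: ler_sum => i _; rewrite ger0_norm.
by rewrite P1 lee_fin lerDl oppr_ge0 leNgt e0.
Qed.

(* For vectors of mass 1, |x - P|_1 = 2 - 2 sum min(x, P). *)
Lemma norm1_sub_le x P M C (a : R) :
  (forall i, 0 <= x i) -> (forall i, i \notin M -> x i = 0) -> mass x M <= 1 ->
  probability_vector P -> (C `<=` M)%fset -> a <= 1 ->
  (forall i, i \in C -> a * P i <= x i) ->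
  (norm1 (x \- P)%R <= (2 * (1 - a * mass P C))%:E)%E.
Proof.
move=> x0 xM x1 PP CM a1 aP; have P0 := PP.1; apply: norm1_le => A.
(* On [C] both [x] and [P] are at least [a * P], so [d] is a lower bound for 2 min(x, P). *)
pose d i := if i \in C then 2 * a * P i else 0.
(* Enlarging [A] by [M] makes the sum cover all of [C] and the whole mass of [x]. *)
have AMU : (A `<=` A `|` M)%fset by exact: fsubsetUl.
have MAU : (M `<=` A `|` M)%fset by exact: fsubsetUr.
have absle i : `|x i - P i| <= x i + P i - d i.
  rewrite /d; case: ifPn => [iC|_].
    have := aP _ iC; have : a * P i <= P i by rewrite ler_piMl.
    by case: (ger0P (x i - P i)) => ? ? ?; lra.
  rewrite subr0 (le_trans (ler_normB _ _)) // !ger0_norm //.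
have: mass (fun i => `|x i - P i|) A <= mass (fun i => `|x i - P i|) (A `|` M)%fset.
  exact: le_mass.
move=> /le_trans; apply.
have sumx : \sum_(i <- (A `|` M)%fset) x i = mass x M.
  by apply/esym/big_fset_incl => // i _ /xM.
have sumd : \sum_(i <- (A `|` M)%fset) d i = 2 * a * mass P C.
  rewrite -(big_fset_incl _ (fsubset_trans CM MAU)) => [|i _ iC]; last first.
    by rewrite /d (negbTE iC).
  by rewrite mulr_sumr big_seq [RHS]big_seq; apply: eq_bigr => i iC; rewrite /d iC.
have := mass_le1 (A `|` M)%fset PP.
have: mass (fun i => `|x i - P i|) (A `|` M)%fset <=
    \sum_(i <- (A `|` M)%fset) (x i + P i - d i) by apply: ler_sum.
rewrite big_split sumrN big_split /= sumx sumd.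
rewrite -/(mass P _); nra.
Qed.

End l1.

(** * Connected components of a bidirectional network *)

Section reachability.
Variables (R : realType) (Omega : choiceType) (gamma : Omega -> Omega -> R).
Hypothesis gamma_bidirectional : forall a b, 0 < gamma a b <-> 0 < gamma b a.
Implicit Types M : {fset Omega}.

(** The list [p] omits the starting point, so [i] itself may lie outside [M]. *)
Definition reach M i j : Prop := exists p : seq Omega,
  [/\ path (link gamma) i p, last i p = j & {in p, forall k, k \in M}].

Lemma reach_trans M i j k : reach M i j -> reach M j k -> reach M i k.
Proof.
move=> [p [pp <- pM]] [q [qq <- qM]]; exists (p ++ q).
rewrite cat_path pp qq last_cat; split => // l.
by rewrite mem_cat => /orP[/pM|/qM].
Qed.

Lemma reach_link M i j : link gamma i j -> j \in M -> reach M i j.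
Proof.
by move=> ij jM; exists [:: j]; rewrite /= ij; split=> // k; rewrite inE => /eqP ->.
Qed.

(** The reversed path drops the old endpoint and lists the old start [i], whence the condition
    [i \in M]. *)
Lemma reach_sym M i j : i \in M -> reach M i j -> reach M j i.
Proof.
move=> iM [p [pp <- pM]]; exists (rev (belast i p)); split.
- rewrite rev_path (eq_path (e' := link gamma)) // => a b.
  by apply/idP/idP; rewrite /link gamma_bidirectional.
- by case: p {pp pM} => //= a p; rewrite rev_cons last_rcons.
- by move=> k; rewrite mem_rev => /mem_belast; rewrite inE => /predU1P[->|/pM].
Qed.

Definition component M r : {fset Omega} :=
  [fset i in M | `[< reach M r i >]]%fset.

Lemma in_component M r i : i \in component M r <-> i \in M /\ reach M r i.
Proof. by rewrite !inE; split => [/andP[-> /asboolP]|[-> /asboolP]]. Qed.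

Lemma component_sub M r : (component M r `<=` M)%fset.
Proof. by apply/fsubsetP => i /in_component[]. Qed.

Lemma component_isolated M r i j : i \in component M r -> j \in M ->
  j \notin component M r -> ~~ link gamma i j /\ ~~ link gamma j i.
Proof.
move=> /in_component[iM ri] jM jC.
suff ij : ~~ link gamma i j.
  by split=> //; apply: contraNN ij; rewrite /link -gamma_bidirectional.
apply: contraNN jC => ij; apply/in_component; split=> //.
exact: reach_trans ri (reach_link ij jM).
Qed.

(** Each vertex of the path is reached by the initial segment ending there, so the path stays in the
    component. *)
Lemma reach_component M r j : reach M r j -> reach (component M r) r j.
Proof.
move=> [p [pp <- pM]]; exists p; split=> // k kp.
apply/in_component; split; first exact: pM.
move: kp pp pM => /splitPr[p1 p2]; rewrite -cat_rcons cat_path => /andP[pp _] pM.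
exists (rcons p1 k); rewrite last_rcons; split=> // l lp.
by apply: pM; rewrite mem_cat lp.
Qed.

(** Two points are joined through the root [r], by reversing a path that starts at [r]. *)
Lemma component_connected M r :
  r \in M -> strongly_connected gamma [set` component M r].
Proof.
move=> rM i j /= /in_component[iM ri] /in_component[jM rj].
have rC : r \in component M r by apply/in_component; split=> //; exists [::].
apply: reach_trans (reach_component rj).
exact/reach_sym/reach_component.
Qed.

Lemma component_supset A r : irreducible gamma ->
  exists K, (A `<=` K)%fset /\
    forall M, (K `<=` M)%fset -> (A `<=` component M r)%fset.
Proof.
move=> irr; have /choice[p hp] : forall a, exists p : seq Omega,
    path (link gamma) r p /\ last r p = a.
  by move=> a; have [//|//|q [? ? _]] := irr r a; exists q.
(* [K] consists of [A] and the vertices of one chosen path from [r] to each point of [A]. *)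
exists (A `|` [fset x in flatten [seq p a | a <- A]])%fset.
split=> [|M /fsubsetP KM]; first exact: fsubsetUl.
apply/fsubsetP => a aA; have [pp la] := hp a.
apply/in_component; split; first by apply: KM; rewrite inE aA.
exists (p a); split=> // k kp; apply: KM; rewrite !inE; apply/orP; right.
by apply/flatten_mapP; exists a.
Qed.

End reachability.

(** * Convergence along the net of finite sets *)

Theorem lemma19 (R : realType) (Omega : choiceType)
    (Omega_countably_infinite : ([set: Omega] #= [set: nat])%card)
    (gamma : Omega -> Omega -> R)
    (gamma_ge0 : forall i j, 0 <= gamma i j)
    (gamma_diag : forall i, gamma i i = 0)
    (gamma_irreducible : irreducible gamma)
    (gamma_bidirectional : forall a b, 0 < gamma a b <-> 0 < gamma b a)
    (P0 Pstar : Omega -> R)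
    (P0_prob : probability_vector P0)
    (Pstar_prob : probability_vector Pstar)
    (M0 : {fset Omega})
    (P0_M0 : 0 < mass P0 M0)
    (Pstar_M0 : 0 < mass Pstar M0)
    (M0_connected : strongly_connected gamma [set` M0])
    (Pinfty_connected : forall M : {fset Omega},
      (M0 `<=` M)%fset -> strongly_connected gamma [set` M] ->
      Pinfty gamma M (restrict_normalize P0 M) = restrict_normalize Pstar M) :
  norm1 (Pinfty gamma M (restrict_normalize P0 M) \- Pstar)
    @[M --> fset_net P0] --> 0%E.
Proof.
have [r rM0] : exists r, r \in M0.
  apply: contrapT => /forallNP M00; move: P0_M0.
  by rewrite /mass big_seq big1 ?ltxx // => i /M00.
have P0_ge0 := P0_prob.1; have Pstar_ge0 := Pstar_prob.1.
have bound (M : {fset Omega}) : (M0 `<=` M)%fset ->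
    (norm1 (Pinfty gamma M (restrict_normalize P0 M) \- Pstar)%R <=
      (2 * (1 - mass P0 (component gamma M r) *
        mass Pstar (component gamma M r)))%:E)%E.
  move=> M0M; set C := component gamma M r.
  have CM : (C `<=` M)%fset := component_sub gamma M r.
  (* Connectedness of [M0] puts it inside the component of [r], so the hypothesis on connected sets
     applies to [C]. *)
  have M0C : (M0 `<=` C)%fset.
    apply/fsubsetP => i iM0; apply/in_component; split; first exact: (fsubsetP M0M).
    have [p [pp lp pM0]] := M0_connected r i rM0 iM0.
    by exists p; split=> // k /pM0; exact: (fsubsetP M0M).
  have P0C : 0 < mass P0 C := lt_le_trans P0_M0 (le_mass P0_ge0 M0C).
  have PstarC : 0 < mass Pstar C := lt_le_trans Pstar_M0 (le_mass Pstar_ge0 M0C).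
  have P0M : 0 < mass P0 M := lt_le_trans P0C (le_mass P0_ge0 CM).
  have supp (P : Omega -> R) (F : {fset Omega}) j :
    j \notin F -> restrict_normalize P F j = 0.
    by rewrite /restrict_normalize => /negbTE ->.
  have P0M_ge0 j : 0 <= restrict_normalize P0 M j.
    by rewrite /restrict_normalize; case: ifP => // _; rewrite divr_ge0 // ltW.
  apply: (norm1_sub_le _ _ _ _ CM) => //.
  - by move=> i; apply: Pinfty_ge0 => // j; exact: supp.
  - by move=> i; apply: Pinfty_eq0 => j; exact: supp.
  - rewrite (le_trans (Pinfty_sum_le gamma_ge0 gamma_diag (supp P0 M) P0M_ge0)) //.
    rewrite big_seq (eq_bigr (fun i => P0 i / mass P0 M)) => [|i iM]; last first.
      by rewrite /restrict_normalize iM.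
    by rewrite -big_seq -mulr_suml divff // gt_eqF.
  - exact: mass_le1.
  - move=> i iC; have c0 : 0 < mass P0 C / mass P0 M by rewrite divr_gt0.
    (* On [C] the two normalizations of [P0] differ by the factor P0(C) / P0(M). *)
    rewrite (@Pinfty_block _ _ _ _ C _ (restrict_normalize P0 C)
      (mass P0 C / mass P0 M)) //.
    + rewrite Pinfty_connected //; last exact/component_connected/(fsubsetP M0M).
      (* The entry is P0(C) Pstar(i) / (P0(M) Pstar(C)), whose denominator is at most 1. *)
      rewrite /restrict_normalize iC mulrACA -[leLHS]mulr1 ler_wpM2l //.
        by rewrite mulr_ge0 // ltW.
      by rewrite -invfM invf_ge1 ?mulr_gt0 // mulr_ile1 ?mass_le1 // ltW.
    + move=> j k jC kM kC.
      have [] := component_isolated gamma_bidirectional jC kM kC.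
      rewrite /link !lt_neqAle !gamma_ge0 !andbT !negbK.
      by move=> /eqP <- /eqP <-.
    + exact: supp.
    + by rewrite gt_eqF.
    + move=> j jC; rewrite /restrict_normalize jC (fsubsetP CM _ jC).
      by field; rewrite !gt_eqF.
move=> U; rewrite /= => -[e /= e0 eU].
(* If both masses of [C] exceed 1 - e/4, then 1 - P0(C) Pstar(C) < e/2 and the bound is below e. *)
have e4 : 0 < e / 4 by rewrite divr_gt0.
have [A1 A1P] := mass_near1 P0_prob e4.
have [A2 A2P] := mass_near1 Pstar_prob e4.
have [K [A0K KC]] := component_supset (M0 `|` (A1 `|` A2))%fset r gamma_irreducible.
have M0K : (M0 `<=` K)%fset by apply: fsubset_trans A0K; exact: fsubsetUl.
exists K => /=; first exact: lt_le_trans P0_M0 (le_mass P0_ge0 M0K).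
move=> M [P0M KM] /=; set y := norm1 _.
have := bound M (fsubset_trans M0K KM); rewrite -/y /=.
set C := component _ _ _ => ye.
have /fsubUsetP[_ /fsubUsetP[A1C A2C]] : (M0 `|` (A1 `|` A2) `<=` C)%fset := KC M KM.
(* Neighbourhoods of 0 in the extended reals are tested on real balls, so the norm must first be
   shown finite. *)
have yE : y = (fine y)%:E.
  rewrite fineK // ge0_fin_numE ?(le_lt_trans ye) ?ltry //.
  by apply: esum_ge0 => i _; rewrite lee_fin.
have y0 : 0 <= fine y by apply: fine_ge0; apply: esum_ge0 => i _; rewrite lee_fin.
rewrite yE; apply: eU; rewrite /ball /= sub0r normrN ger0_norm //.
rewrite yE lee_fin in ye; apply: le_lt_trans ye _.
have := le_mass P0_ge0 A1C; have := le_mass Pstar_ge0 A2C.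
have := mass_le1 C P0_prob; have := mass_le1 C Pstar_prob.
nra.
Qed.
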